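(* Let $\delta>0$, let $\mathcal{X}_k=\{x_i\}_{i=1}^{N_k}\subset\mathbb{R}^D$ satisfy the two-subspaces criterion, and let $A_k$ be a real symmetric $D\times D$ matrix with $\operatorname{tr}(A_k)=0$ and $$\|A_k\|_2\le \frac{1}{\operatorname{tr}\left(\left(\sum_{x\in\mathcal{X}_k}\frac{xx^T}{2\max(\|x\|,\delta)}\right)^{-1}\right)}.$$ Define $\{Q_k^t\}_{t\ge 0}$ by $Q_k^0=I/D$ and, for $t\ge 0$, let $Q_k^{t+1}$ be the trace-one solution $P$ of the Lyapunov equation $$P\left(\sum_{x\in\mathcal{X}_k}\frac{xx^T}{2\max(\|Q_k^t x\|,\delta)}\right)+\left(\sum_{x\in\mathcal{X}_k}\frac{xx^T}{2\max(\|Q_k^t x\|,\delta)}\right)P+A_k=c\,I,$$ where $c\in\mathbb{R}$ is the (unique) number for which the solution $P$ has $\operatorname{tr}(P)=1$. Then $\{Q_k^t\}_{t\in\mathbb{N}}$ $r$-linearly converges to the unique minimizer over $Q\in\mathbb{H}$ of $$G_k^\delta(Q)=\sum_{x\in\mathcal{X}_k,\ \|Qx\|\ge\delta}\|Qx\|+\sum_{x\in\mathcal{X}_k,\ \|Qx\|<\delta}\left(\frac{\|Qx\|^2}{2\delta}+\frac{\delta}{2}\right)+\operatorname{tr}(QA_k).$$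
   Context: $\|\cdot\|$ on vectors is the Euclidean norm and $\|\cdot\|_2$ is the spectral norm of a matrix. $\mathbb{H}$ is the set of real symmetric $D\times D$ matrices $Q$ with $\operatorname{tr}(Q)=1$ (not assumed positive semi-definite). Two-subspaces criterion: a dataset $\mathcal{Y}\subset\mathbb{R}^D$ satisfies it if $(\mathcal{Y}\cap L_1)\cup(\mathcal{Y}\cap L_2)\ne\mathcal{Y}$ for all $(D-1)$-dimensional linear subspaces $L_1,L_2\subset\mathbb{R}^D$. (In particular such a dataset is full rank, i.e. spans $\mathbb{R}^D$.) $r$-linear convergence: a sequence $\{y_t\}$ $r$-linearly converges to $y$ if there exists a real sequence $\{v_t\}$ such that $\|y_t-y\|<v_t$ for all $t$, and there exists $q\in(0,1)$ such that $v_{t+1}\le q\,v_t$ for all $t$ sufficiently large. For matrices, $\|\cdot\|$ is any fixed matrix norm. *)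

(* Defs.v *)
From mathcomp Require Import all_boot all_order all_algebra.
From mathcomp Require Import all_classical all_reals all_analysis.

Set Implicit Arguments.
Unset Strict Implicit.
Unset Printing Implicit Defensive.

Import Order.TTheory GRing.Theory Num.Theory.
Local Open Scope classical_set_scope.
Local Open Scope ring_scope.

(* The library norm `|v| on matrices is the sup norm, hence this definition. *)
Definition enorm (R : realType) (n : nat) (v : 'cV[R]_n) : R :=
  Num.sqrt (\sum_i v i 0 ^+ 2).

Definition spectral_norm (R : realType) (n : nat) (A : 'M[R]_n) : R :=
  sup [set enorm (A *m v) | v in [set v : 'cV[R]_n | enorm v <= 1]].

Definition matrix_norm (R : realType) (n : nat) (nrm : 'M[R]_n -> R) : Prop :=
  [/\ forall M, 0 <= nrm M,
      forall M, nrm M = 0 -> M = 0,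
      forall a M, nrm (a *: M) = `|a| * nrm M
    & forall M N, nrm (M + N) <= nrm M + nrm N].

Definition rlinear_cvg (R : realType) (n : nat) (nrm : 'M[R]_n -> R)
    (y : nat -> 'M[R]_n) (l : 'M[R]_n) : Prop :=
  exists v : nat -> R, (forall t, nrm (y t - l) < v t) /\
    exists2 q : R, 0 < q < 1 & \forall t \near \oo, v t.+1 <= q * v t.

Definition two_subspaces (R : realType) (D : nat) (Y : set 'cV[R]_D) : Prop :=
  forall L1 L2 : {vspace 'cV[R]_D}, \dim L1 = D.-1 -> \dim L2 = D.-1 ->
    (Y `&` [set` L1]) `|` (Y `&` [set` L2]) <> Y.

Definition trace_one_sym (R : realType) (D : nat) : set 'M[R]_D :=
  [set Q | Q^T = Q /\ \tr Q = 1].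

(* A data set is a finite family of points: sums over it count repeated points
   with multiplicity. *)
Definition weighted_scatter (R : realType) (D N : nat) (x : 'I_N -> 'cV[R]_D)
    (delta : R) (w : 'I_N -> R) : 'M[R]_D :=
  \sum_(i < N) (2 * Num.max (w i) delta)^-1 *: (x i *m (x i)^T).

Definition gms_objective (R : realType) (D N : nat) (x : 'I_N -> 'cV[R]_D)
    (delta : R) (A Q : 'M[R]_D) : R :=
  \sum_(i < N | delta <= enorm (Q *m x i)) enorm (Q *m x i)
  + \sum_(i < N | enorm (Q *m x i) < delta)
      (enorm (Q *m x i) ^+ 2 / (2 * delta) + delta / 2)
  + \tr (Q *m A).

Definition is_minimizer (T : Type) (R : realType) (H : set T) (G : T -> R)
    (Q : T) : Prop :=
  H Q /\ forall P, H P -> G Q <= G P.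

Definition lyapunov_solution (R : realType) (D : nat) (S A : 'M[R]_D) (c : R)
    (P : 'M[R]_D) : Prop :=
  P *m S + S *m P + A = c%:M.

Definition trace_one_lyapunov_solution (R : realType) (D : nat)
    (S A P : 'M[R]_D) : Prop :=
  exists c : R,
    unique (fun c' => exists2 P', lyapunov_solution S A c' P' & \tr P' = 1) c
    /\ unique (lyapunov_solution S A c) P /\ \tr P = 1.

Definition gms_iteration (R : realType) (D N : nat) (x : 'I_N -> 'cV[R]_D)
    (delta : R) (A : 'M[R]_D) (Q : nat -> 'M[R]_D) : Prop :=
  Q 0%N = (D%:R^-1)%:M /\
  forall t, trace_one_lyapunov_solution
    (weighted_scatter x delta (fun i => enorm (Q t *m x i))) A (Q t.+1).

(* Main.v *)
Require Import Defs.
From mathcomp Require Import all_boot all_order all_algebra.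
From mathcomp Require Import all_classical all_reals all_analysis.
From mathcomp Require Import ring lra.

Set Implicit Arguments.
Unset Strict Implicit.
Unset Printing Implicit Defensive.

Import Order.TTheory GRing.Theory Num.Theory.
Import numFieldNormedType.Exports.
Local Open Scope classical_set_scope.
Local Open Scope ring_scope.

(** The iteration is a majorize-minimize scheme.  Let [h r] be the minimum over
    [m >= delta] of [r ^+ 2 / (2 * m) + m / 2], attained at [m = max r delta];
    the objective is the sum of the [h |Q x_i|] plus [\tr (Q A)].  Freezing the
    weights [m_i = max |Q x_i| delta] gives a quadratic majorant that touches the
    objective at [Q], and whose stationarity condition on symmetric matrices of
    trace one is the Lyapunov equation defining the next iterate [P].  Hence the
    objective decreases by at least the sum of the [|(P - Q) x_i| ^+ 2 / (2 * m_i)]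
    (objective_descent), and a minimizer is a fixed point of the iteration
    (minimizer_stationary).

    In the other direction, the first-order expansion of the objective
    at [Q] is exceeded at [P] by at least a weighted sum of the squared components
    of the [(P - Q) x_i] that are transversal to [Q x_i] (objective_bregman).  For
    distinct symmetric [P], [Q] of trace one this sum is positive
    (transversal_energy_gt0): were all of them parallel, the pencil spanned by [Q]
    and [P - Q] would have all data as generalized eigenvectors; by symmetry
    those of different eigenvalues are orthogonal for [Q], so an eigenspace and
    one hyperplane would contain all data.  By the two-subspaces criterion the
    eigenspace is then the whole space, so [P - Q] is a multiple of [Q], and it is
    0 because its trace is.  This makes the minimizer unique, and as the
    transversal energy is a quadratic form, compactness of the unit sphere turns
    positivity into quadratic growth of the objective on sublevel sets
    (distance_le_gap).

    The hypothesis on [A] bounds [\tr (Q A)], in absolute value, by half of the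
    sum of the [|Q x_i|] (trace_mul_le_half_sum).  So sublevel sets are
    bounded, a minimizer exists, and the weights stay bounded along the
    iteration.

    Finally the gap [e_t] between the objective at the t-th iterate and its
    minimum is bounded by the slope at this iterate towards the minimizer.  The
    Lyapunov equation rewrites this slope as a weighted inner product of the
    displacement to the minimizer with the step.  The former is at most of order
    [sqrt e_t] by quadratic growth, the latter of order [sqrt (e_t - e_(t+1))] by
    descent, so that [e_t] is at most a constant times [e_t - e_(t+1)] (gap_contraction): the gaps decay
    geometrically, and with them the squared distances to the minimizer. *)

(** * The Euclidean inner product *)

Section InnerProduct.
Variables (R : realType) (n : nat).
Implicit Types (u v w : 'cV[R]_n) (M : 'M[R]_n) (a : R).

Definition dot u v : R := \sum_i u i 0 * v i 0.

Lemma dotC u v : dot u v = dot v u.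
Proof. by apply: eq_bigr => i _; rewrite mulrC. Qed.

Lemma dotDl u v w : dot (u + v) w = dot u w + dot v w.
Proof. by rewrite /dot -big_split; apply: eq_bigr => i _; rewrite mxE mulrDl. Qed.

Lemma dotZl a u v : dot (a *: u) v = a * dot u v.
Proof. by rewrite /dot mulr_sumr; apply: eq_bigr => i _; rewrite mxE mulrA. Qed.

Lemma dotNl u v : dot (- u) v = - dot u v.
Proof. by rewrite -scaleN1r dotZl mulN1r. Qed.

Lemma dotBl u v w : dot (u - v) w = dot u w - dot v w.
Proof. by rewrite dotDl dotNl. Qed.

Lemma dotDr u v w : dot u (v + w) = dot u v + dot u w.
Proof. by rewrite dotC dotDl !(dotC u). Qed.

Lemma dotBr u v w : dot u (v - w) = dot u v - dot u w.
Proof. by rewrite dotC dotBl !(dotC u). Qed.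

Lemma dotZr a u v : dot u (a *: v) = a * dot u v.
Proof. by rewrite dotC dotZl dotC. Qed.

Lemma dot0l v : dot 0 v = 0.
Proof. by rewrite -(scale0r 0) dotZl mul0r. Qed.

Lemma dotE u v : dot u v = \tr (u^T *m v).
Proof. by rewrite trace_mx11 mxE; apply: eq_bigr => i _; rewrite mxE. Qed.

Lemma dot_mull M u v : dot (M *m u) v = dot u (M^T *m v).
Proof. by rewrite !dotE trmx_mul mulmxA. Qed.

Lemma dot_ge0 u : 0 <= dot u u.
Proof. by apply: sumr_ge0 => i _; rewrite -expr2 sqr_ge0. Qed.

Lemma dot_eq0 u : dot u u = 0 -> u = 0.
Proof.
move=> /psumr_eq0P u0; apply/colP => i; rewrite mxE; apply/eqP.
by rewrite -sqrf_eq0 expr2 u0 // => j _; rewrite -expr2 sqr_ge0.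
Qed.

Lemma dot_gt0 u : u != 0 -> 0 < dot u u.
Proof.
by move=> u0; rewrite lt0r dot_ge0 andbT; apply: contraNneq u0 => /dot_eq0->.
Qed.

(** Expand the squared length of [dot v v *: u - dot u v *: v]. *)
Lemma dot_sqr_le u v : dot u v ^+ 2 <= dot u u * dot v v.
Proof.
have [-> | /dot_gt0 v_gt0] := eqVneq v 0.
  by rewrite dotC !dot0l mulr0 expr0n.
have := dot_ge0 (dot v v *: u - dot u v *: v).
rewrite dotBl !dotBr !dotZl !dotZr (dotC v u).
move: (dot u u) (dot v v) (dot u v) v_gt0 => a b c b_gt0.
set e := (X in 0 <= X); have -> : e = b * (a * b - c ^+ 2) by rewrite /e; ring.
by rewrite pmulr_rge0 // subr_ge0.
Qed.

Lemma enorm_ge0 u : 0 <= enorm u.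
Proof. exact: sqrtr_ge0. Qed.

Lemma enorm_sqr u : enorm u ^+ 2 = dot u u.
Proof.
have -> : dot u u = \sum_i u i 0 ^+ 2 by apply: eq_bigr => i _; rewrite expr2.
by rewrite sqr_sqrtr //; apply: sumr_ge0 => i _; exact: sqr_ge0.
Qed.

Lemma enorm0_eq0 u : enorm u = 0 -> u = 0.
Proof. by move=> u0; apply: dot_eq0; rewrite -enorm_sqr u0 expr0n. Qed.

Lemma enormZ a u : enorm (a *: u) = `|a| * enorm u.
Proof.
apply/eqP; rewrite -(eqrXn2 (n := 2)) ?mulr_ge0 ?enorm_ge0 //.
by rewrite exprMn !enorm_sqr dotZl dotZr real_normK ?num_real // expr2 mulrA.
Qed.

Lemma normr_dot_le u v : `|dot u v| <= enorm u * enorm v.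
Proof.
rewrite -(ler_pXn2r (n := 2)) ?nnegrE ?mulr_ge0 ?enorm_ge0 //.
by rewrite exprMn !enorm_sqr real_normK ?num_real // dot_sqr_le.
Qed.

End InnerProduct.

(** * Scatter matrices and the Lyapunov operator *)

Section Scatter.
Variables (R : realType) (D N : nat) (x : 'I_N -> 'cV[R]_D).
Implicit Types (P Q : 'M[R]_D) (w : 'I_N -> R) (delta : R).

Lemma scatter_sym delta w :
  (weighted_scatter x delta w)^T = weighted_scatter x delta w.
Proof.
rewrite /weighted_scatter linear_sum; apply: eq_bigr => i _.
by rewrite linearZ /= trmx_mul trmxK.
Qed.

Lemma trace_scatter delta w P Q :
  \tr (P^T *m (Q *m weighted_scatter x delta w)) =
  \sum_i (2 * Num.max (w i) delta)^-1 * dot (P *m x i) (Q *m x i).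
Proof.
rewrite /weighted_scatter !mulmx_sumr linear_sum; apply: eq_bigr => i _.
rewrite -!scalemxAr linearZ /= dotE trmx_mul; congr (_ * _).
by rewrite !mulmxA mxtrace_mulC !mulmxA.
Qed.

Lemma dot_scatter delta w u v :
  dot u (weighted_scatter x delta w *m v) =
  \sum_i (2 * Num.max (w i) delta)^-1 * (dot u (x i) * dot (x i) v).
Proof.
rewrite /weighted_scatter mulmx_suml dotE mulmx_sumr linear_sum.
apply: eq_bigr => i _; rewrite -!scalemxAl -!scalemxAr linearZ /=.
congr (_ * _); rewrite /dot !mulmxA -mulmxA mxtrace_mulC trace_mx11 !mxE.
rewrite big_ord1 !mxE mulrC; congr (_ * _);
  by apply: eq_bigr => j _; rewrite mxE // mulrC.
Qed.

End Scatter.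

(** * Consequences of the two-subspaces criterion *)

Section TwoSubspaces.
Variables (R : realType) (D N : nat) (x : 'I_N -> 'cV[R]_D).
Hypothesis x_two : two_subspaces (range x).
Implicit Types (u v : 'cV[R]_D) (Q M : 'M[R]_D).

Lemma hyperplane_exists u : u != 0 ->
  exists2 L : {vspace 'cV[R]_D}, \dim L = D.-1 & forall v, (v \in L) = (dot u v == 0).
Proof.
move=> u0; have D_gt0 : (0 < D)%N.
  rewrite lt0n; apply: contra_neq u0 => D0; apply/colP => i.
  by have := ltn_ord i; rewrite [X in (_ < X)%N]D0.
pose f : 'Hom('cV[R]_D, 'M[R]_1) := linfun (mulmx u^T).
have fE v : f v = (dot u v)%:M.
  by rewrite lfunE [LHS]mx11_scalar; congr (_%:M); rewrite dotE trace_mx11.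
exists (lker f); last first.
  move=> v; rewrite memv_ker fE; apply/eqP/eqP => [/matrixP/(_ 0 0)|->].
    by rewrite !mxE mulr1n.
  exact: raddf0.
have dimf : \dim (limg f) = 1%N.
  apply/eqP; rewrite eqn_leq; apply/andP; split.
    by rewrite (leq_trans (dimvS (subvf _))) // dimvf /dim /= mul1n.
  rewrite lt0n dimv_eq0; apply: contra_neq (lt0r_neq0 (dot_gt0 u0)) => f0.
  have : f u \in limg f by rewrite memv_img ?memvf.
  by rewrite f0 memv0 fE => /eqP/matrixP/(_ 0 0); rewrite !mxE mulr1n.
have := limg_ker_dim f fullv; rewrite capfv dimf addn1 dimvf => dimE.
by apply/eqP; rewrite -eqSS dimE /dim /= muln1; rewrite prednK.
Qed.

Lemma two_hyperplanes_do_not_cover u v : u != 0 -> v != 0 ->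
  exists i, dot u (x i) != 0 /\ dot v (x i) != 0.
Proof.
move=> /hyperplane_exists[L1 dL1 inL1] /hyperplane_exists[L2 dL2 inL2].
apply: contrapT => none; apply: (x_two dL1 dL2); apply/seteqP; split=> y.
  by case=> -[].
case=> i _ <-; have [u0|u0] := eqVneq (dot u (x i)) 0; [left|right];
  (split; first by exists i) => /=; rewrite ?inL1 ?inL2 ?u0 //.
by apply: contrapT => /negP v0; apply: none; exists i.
Qed.

Lemma nonzero_row M : M != 0 -> exists j, (row j M)^T != 0.
Proof.
move=> /matrix0Pn[j [k Mjk]]; exists j; apply: contra_neq Mjk.
by move=> /matrixP/(_ k 0); rewrite !mxE.
Qed.

Lemma mulmx_points_eq0 M : (forall i, M *m x i = 0) -> M = 0.
Proof.
move=> Mx; have [//|/nonzero_row[j Mj0]] := eqVneq M 0.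
have [i [+ _]] := two_hyperplanes_do_not_cover Mj0 Mj0.
by rewrite dotE trmxK -row_mul Mx row0 mxtrace0 eqxx.
Qed.

(** If [M *m x i = a *: Q *m x i] with [Q *m x i != 0], and [b] is the eigenvalue
    of another point [x j], symmetry evaluates the inner product of [x i] and
    [M *m x j] in two ways, so [b = a] unless [x j] lies in the hyperplane
    orthogonal to [Q *m x i].  The points of eigenvalue [a] lie in the kernel of
    [M - a *: Q], which is within a hyperplane too unless this matrix is 0. *)
Lemma pencil_common_eigenvalue Q M : Q^T = Q -> M^T = M -> Q != 0 ->
  (forall i, exists a, M *m x i = a *: (Q *m x i)) -> exists a, M = a *: Q.
Proof.
move=> Qs Ms Q0 eigx.
have [i Qxi0] : exists i, Q *m x i != 0.
  apply: contrapT => none; move/eqP: Q0; apply; apply: mulmx_points_eq0 => i.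
  by apply: contrapT => /eqP Qxi0; apply: none; exists i.
have [a Mxi] := eigx i; exists a; apply/eqP; rewrite -subr_eq0; apply/eqP.
have [//|/nonzero_row[k Tk0]] := eqVneq (M - a *: Q) 0.
have [j [Qxij]] := two_hyperplanes_do_not_cover Qxi0 Tk0.
have [b Mxj] := eigx j.
have ba : b = a.
  apply: (mulIf Qxij); apply: esym; rewrite -dotZl -Mxi !dot_mull Qs Ms Mxj.
  by rewrite dotZr.
by rewrite dotE trmxK -row_mul mulmxBl Mxj ba -scalemxAl subrr row0 mxtrace0 eqxx.
Qed.

Lemma no_flat_direction Q M : Q^T = Q -> \tr Q = 1 -> M^T = M -> \tr M = 0 ->
  (forall i, exists a, M *m x i = a *: (Q *m x i)) -> M = 0.
Proof.
move=> Qs Q1 Ms M0 eigx; have Qn0 : Q != 0.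
  by apply: contra_eq_neq Q1 => ->; rewrite mxtrace0 eq_sym oner_neq0.
have [a Ma] := pencil_common_eigenvalue Qs Ms Qn0 eigx.
by move: M0; rewrite Ma linearZ /= Q1 mulr1 => ->; rewrite scale0r.
Qed.

End TwoSubspaces.

(** * The Lyapunov equation *)

Section Lyapunov.
Variables (R : realType) (D N : nat) (x : 'I_N -> 'cV[R]_D) (delta : R).
Hypotheses (D_gt0 : (0 < D)%N) (delta_gt0 : 0 < delta).
Hypothesis x_two : two_subspaces (range x).
Variable w : 'I_N -> R.
Let S := weighted_scatter x delta w.
Implicit Types A P B : 'M[R]_D.

Lemma weight_gt0 (r : R) : 0 < (2 * Num.max r delta)^-1.
Proof. by rewrite invr_gt0 mulr_gt0 ?lt_max ?delta_gt0 ?orbT. Qed.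

Lemma scatter_energy_eq0 P :
  \sum_i (2 * Num.max (w i) delta)^-1 * dot (P *m x i) (P *m x i) <= 0 -> P = 0.
Proof.
move=> E0; have t_ge0 i : 0 <= (2 * Num.max (w i) delta)^-1 * dot (P *m x i) (P *m x i).
  by rewrite mulr_ge0 ?dot_ge0 // ltW // weight_gt0.
apply: (mulmx_points_eq0 x_two) => i; apply: dot_eq0.
have E1 :
    \sum_i (2 * Num.max (w i) delta)^-1 * dot (P *m x i) (P *m x i) = 0.
  by apply/eqP; rewrite eq_le E0 sumr_ge0.
have /eqP := psumr_eq0P (fun j _ => t_ge0 j) E1 (i := i) isT.
by rewrite mulf_eq0 gt_eqF ?weight_gt0 //= => /eqP.
Qed.

(** Pairing the equation with [P^T] gives a sum of two nonnegative energies, one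
    of [P] and one of [P^T]. *)
Lemma lyapunov_inj P : P *m S + S *m P = 0 -> P = 0.
Proof.
move=> P0; apply: scatter_energy_eq0; rewrite -trace_scatter -/S.
have : \tr (P^T *m (P *m S + S *m P)) = 0 by rewrite P0 mulmx0 mxtrace0.
rewrite mulmxDr linearD /= => /eqP; rewrite addr_eq0 => /eqP->.
rewrite oppr_le0 mulmxA mxtrace_mulC -[X in X *m _]trmxK trace_scatter.
by apply: sumr_ge0 => i _; rewrite mulr_ge0 ?dot_ge0 // ltW // weight_gt0.
Qed.

Lemma lyapunov_surj B : exists P, P *m S + S *m P = B.
Proof.
pose L : 'M[R]_(D * D) := lin_mulmxr S + lin_mulmx S.
have LE P : mxvec P *m L = mxvec (P *m S + S *m P).
  by rewrite mulmxDr !mul_vec_lin raddfD.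
have Lfree : row_free L.
  apply: inj_row_free => v; rewrite -[v]vec_mxK LE => v0.
  by rewrite (lyapunov_inj (P := vec_mx v)) ?raddf0 // -[LHS]mxvecK v0 raddf0.
have Lu : L \in unitmx by rewrite -row_free_unit.
exists (vec_mx (mxvec B *m invmx L)).
by rewrite -[LHS]mxvecK -LE vec_mxK mulmxKV ?mxvecK.
Qed.

Lemma lyapunov_sym A P : A^T = A -> P *m S + S *m P = A -> P^T = P.
Proof.
move=> As PS; apply/eqP; rewrite -subr_eq0; apply/eqP; apply: lyapunov_inj.
have : (P *m S + S *m P)^T = P *m S + S *m P by rewrite PS.
rewrite raddfD /= !trmx_mul scatter_sym -/S addrC => PtS.
by rewrite mulmxBl mulmxBr addrACA -opprD PtS subrr.
Qed.

(** With [P0] and [P1] the solutions for right-hand sides 1 and [A], the solution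
    for a given constant [c] is [c *: P0 - P1].  Its trace is a nonconstant affine
    function of [c] because [\tr P0] is twice the energy of [P0], hence
    positive. *)
Lemma trace_one_lyapunov_unique_existence A :
  exists! P, trace_one_lyapunov_solution S A P.
Proof.
have [P0 P0E] := lyapunov_surj 1%:M; have [P1 P1E] := lyapunov_surj A.
have P0s : P0^T = P0 by apply: lyapunov_sym P0E; exact: tr_scalar_mx.
have P0_gt0 : 0 < \tr P0.
  have tr2 : \tr P0 =
      2 * \sum_i (2 * Num.max (w i) delta)^-1 * dot (P0 *m x i) (P0 *m x i).
    rewrite -trace_scatter -/S P0s -[P0 in LHS]mulmx1 -P0E mulmxDr linearD /=.
    by rewrite [X in _ + X]mxtrace_mulC -mulmxA [X in _ + X]mxtrace_mulC -mulmxA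
         mulr_natl.
  rewrite tr2 pmulr_rgt0 // ltNge; apply/negP => /scatter_energy_eq0 P00.
  move: P0E; rewrite P00 mul0mx mulmx0 addr0.
  move=> /matrixP/(_ (Ordinal D_gt0) (Ordinal D_gt0)).
  by rewrite !mxE eqxx => /eqP; rewrite eq_sym oner_eq0.
have solE c P : lyapunov_solution S A c P <-> P = c *: P0 - P1.
  rewrite /lyapunov_solution; split=> [PE|->].
    apply/eqP; rewrite -subr_eq0; apply/eqP/lyapunov_inj.
    rewrite !mulmxBl !mulmxBr -!scalemxAl -!scalemxAr.
    rewrite [X in X = _](_ : _ = (P *m S + S *m P + A) - c *: (P0 *m S + S *m P0)
              + (P1 *m S + S *m P1 - A)); last first.
      by rewrite scalerDr; apply/matrixP => i j; rewrite !mxE; ring.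
    by rewrite PE P0E P1E scalemx1 !subrr addr0.
  rewrite mulmxBl mulmxBr -scalemxAl -scalemxAr addrACA -scalerDr P0E -opprD P1E.
  by rewrite subrK scalemx1.
pose c := (1 + \tr P1) / \tr P0.
have trE c' : \tr (c' *: P0 - P1) = 1 <-> c' = c.
  rewrite raddfB /= linearZ /=; split=> [tr1|->].
    by rewrite /c -tr1 subrK mulfK ?gt_eqF.
  by rewrite divfK ?gt_eqF // addrK.
exists (c *: P0 - P1); split.
  exists c; split; last split.
  - split; first by exists (c *: P0 - P1); [apply/solE | apply/trE].
    by move=> c' [P' /solE-> /trE].
  - by split; [apply/solE | move=> P' /solE].
  - exact/trE.
move=> P [c' [_ [[/solE PE _] tr1]]].
by move: tr1; rewrite PE => /trE->.
Qed.

End Lyapunov.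

Lemma trace_one_lyapunov_sym (R : realType) (D : nat) (S A P : 'M[R]_D) :
  S^T = S -> A^T = A -> trace_one_lyapunov_solution S A P ->
  P^T = P /\ \tr P = 1 /\ exists c, P *m S + S *m P + A = c%:M.
Proof.
move=> Ss As [c [_ [[PE uP] tr1]]]; split; last by split=> //; exists c.
symmetry; apply: uP; rewrite /lyapunov_solution -[RHS]tr_scalar_mx -PE.
by rewrite !raddfD /= !trmx_mul Ss As [_ *m S + _]addrC.
Qed.

(** * The Huber-regularized absolute value *)

Section Huber.
Variables (R : realType) (delta : R).
Hypothesis delta_gt0 : 0 < delta.
Implicit Types (a b c m r : R).

Definition huber r : R := r ^+ 2 / (2 * Num.max r delta) + Num.max r delta / 2.

Lemma cap_gt0 r : 0 < Num.max r delta.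
Proof. by rewrite lt_max delta_gt0 orbT. Qed.

(** The majorization behind the iteration: freezing the weight can only increase
    the value.  With [p] the optimal weight, the gap factors as
    [(m - p) * (m * p - r ^+ 2) / (2 * m * p)]. *)
Lemma huber_le r m : 0 <= r -> delta <= m -> huber r <= r ^+ 2 / (2 * m) + m / 2.
Proof.
move=> r0 dm; have m_gt0 := lt_le_trans delta_gt0 dm.
rewrite /huber -subr_ge0; set e := (X in 0 <= X).
have p_gt0 := cap_gt0 r; set p := Num.max r delta in e p_gt0 *.
have -> : e = (m - p) * (m * p - r ^+ 2) / (2 * m * p).
  by rewrite /e; field; rewrite !gt_eqF.
apply: divr_ge0; last by rewrite !mulr_ge0 ?ltW.
have [dr|rd] := leP delta r.
  have -> : p = r by apply/max_idPl.
  by rewrite expr2 -mulrBl mulrA mulr_ge0 // -expr2 sqr_ge0.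
have -> : p = delta by apply/max_idPr; exact: ltW.
rewrite mulr_ge0 ?subr_ge0 // expr2 ler_pM // ltW //.
exact: lt_le_trans rd dm.
Qed.

Lemma le_huber r : r <= huber r.
Proof.
rewrite -subr_ge0 /huber; set e := (X in 0 <= X).
have p_gt0 := cap_gt0 r; set p := Num.max r delta in e p_gt0 *.
have -> : e = (r - p) ^+ 2 / (2 * p) by rewrite /e; field; rewrite !gt_eqF.
by rewrite divr_ge0 ?sqr_ge0 // mulr_ge0 ?ltW.
Qed.

(** Here [a] and [c] are the norms of two vectors [y] and [z], [b] is their
    inner product, so that [b - a ^+ 2] is the inner product of [y] and
    [d = z - y], and [c ^+ 2 - 2 * b + a ^+ 2] the squared norm of [d].  With
    [m], [m'] the two truncated norms and [s = m' - m], twice [m'] times the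
    gap between the two sides is
    [(s - <y, d> / m) ^+ 2 + s * (m ^+ 2 - a ^+ 2) / m],
    and the last term is nonnegative: either [m = a], or [m = delta <= m']. *)
Lemma huber_bregman a b c m m' :
  0 <= a -> m = Num.max a delta -> m' = Num.max c delta ->
  huber a + m^-1 * (b - a ^+ 2)
    + (c ^+ 2 - 2 * b + a ^+ 2 - (b - a ^+ 2) ^+ 2 / m ^+ 2) / (2 * m')
  <= huber c.
Proof.
move=> a0 mE m'E; rewrite -subr_ge0 /huber -mE -m'E; set e := (X in 0 <= X).
have m_gt0 : 0 < m by rewrite mE cap_gt0.
have m'_gt0 : 0 < m' by rewrite m'E cap_gt0.
have -> : e = ((m' - m - (b - a ^+ 2) / m) ^+ 2
                 + (m' - m) * (m ^+ 2 - a ^+ 2) / m) / (2 * m').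
  by rewrite /e; field; rewrite !gt_eqF.
rewrite divr_ge0 ?mulr_ge0 ?(ltW m'_gt0) // addr_ge0 ?sqr_ge0 //.
rewrite divr_ge0 ?(ltW m_gt0) //; have [da|ad] := leP delta a.
  have -> : m = a by rewrite mE; apply/max_idPl.
  by rewrite subrr mulr0.
have md : m = delta by rewrite mE; apply/max_idPr; exact: ltW.
rewrite mulr_ge0 ?subr_ge0 ?md ?m'E ?le_max ?lexx ?orbT //.
by rewrite ler_pXn2r ?nnegrE // ltW.
Qed.

End Huber.

(** * The objective *)

Section Objective.
Variables (R : realType) (D N : nat) (x : 'I_N -> 'cV[R]_D) (delta : R) (A : 'M[R]_D).
Hypothesis delta_gt0 : 0 < delta.
Implicit Types (P Q M : 'M[R]_D).

Let m Q i := Num.max (enorm (Q *m x i)) delta.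
Let S Q := weighted_scatter x delta (fun i => enorm (Q *m x i)).
Let G := gms_objective x delta A.

Let m_gt0 Q i : 0 < m Q i.
Proof. exact: cap_gt0. Qed.

Let dot_le_cap Q i : dot (Q *m x i) (Q *m x i) <= m Q i ^+ 2.
Proof.
rewrite -enorm_sqr lerXn2r // ?nnegrE ?enorm_ge0 ?(ltW (m_gt0 _ _)) //.
by rewrite /m le_max lexx.
Qed.

Lemma objectiveE Q :
  gms_objective x delta A Q = \sum_i huber delta (enorm (Q *m x i)) + \tr (Q *m A).
Proof.
rewrite /gms_objective [in RHS](bigID (fun i => delta <= enorm (Q *m x i))) /=.
congr (_ + _ + _); last first.
  apply: eq_big => i; first by rewrite ltNge.
  by move=> lti; rewrite /huber max_r ?ltW.
apply: eq_bigr => i lei; rewrite /huber max_l //.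
have r0 := lt_le_trans delta_gt0 lei.
by field; rewrite gt_eqF.
Qed.

(** The left-hand side is the derivative at [P] in direction [M] of the quadratic
    majorant whose weights are those of [Q]; for [P = Q] it is the derivative of
    the objective itself. *)
Lemma gradient_pairing Q P M : P^T = P -> M^T = M ->
  \tr (M *m (P *m S Q + S Q *m P + A)) =
  \sum_i (m Q i)^-1 * dot (P *m x i) (M *m x i) + \tr (M *m A).
Proof.
move=> Ps Ms; rewrite !mulmxDr !linearD /=; congr (_ + _).
have -> : \tr (M *m (S Q *m P)) = \tr (P^T *m (M *m S Q)).
  by rewrite mulmxA mxtrace_mulC Ps.
rewrite -[M in M *m (P *m _)]Ms !trace_scatter -big_split; apply: eq_bigr => i _ /=.
rewrite -/(m Q i) [dot (M *m _) _]dotC.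
by field; rewrite gt_eqF // m_gt0.
Qed.

(** Where [|Q x_i| >= delta], the summand is the squared length of the component
    of [M x_i] orthogonal to [Q x_i]; elsewhere it vanishes only if [M x_i = 0]. *)
Definition transversal_energy Q M : R :=
  \sum_i (dot (M *m x i) (M *m x i)
          - dot (Q *m x i) (M *m x i) ^+ 2 / m Q i ^+ 2).

Lemma transversal_energy_term_ge0 Q M i :
  0 <= dot (M *m x i) (M *m x i) - dot (Q *m x i) (M *m x i) ^+ 2 / m Q i ^+ 2.
Proof.
rewrite subr_ge0 ler_pdivrMr ?exprn_gt0 ?m_gt0 //.
by rewrite (le_trans (dot_sqr_le _ _)) // mulrC ler_wpM2l ?dot_ge0.
Qed.

Lemma transversal_energy_ge0 Q M : 0 <= transversal_energy Q M.
Proof. by apply: sumr_ge0 => i _; exact: transversal_energy_term_ge0. Qed.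

Lemma transversal_energyZ Q a M :
  transversal_energy Q (a *: M) = a ^+ 2 * transversal_energy Q M.
Proof.
rewrite /transversal_energy mulr_sumr; apply: eq_bigr => i _.
by rewrite -scalemxAl !dotZl !dotZr; field; rewrite gt_eqF // m_gt0.
Qed.

(** Each vanishing summand is an equality case of the Cauchy-Schwarz inequality,
    so it makes [M x_i] a multiple of [Q x_i]. *)
Lemma transversal_energy_gt0 Q M : two_subspaces (range x) ->
  Q^T = Q -> \tr Q = 1 -> M^T = M -> \tr M = 0 -> M != 0 ->
  0 < transversal_energy Q M.
Proof.
move=> x_two Qs Q1 Ms M0 Mn0; rewrite lt0r transversal_energy_ge0 andbT.
apply: contra_neq Mn0 => E0; apply: (no_flat_direction x_two Qs Q1 Ms M0) => i.
have /eqP := psumr_eq0P (fun j _ => transversal_energy_term_ge0 Q M j) E0 (i := i) isT.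
set y := Q *m x i; set d := M *m x i; rewrite subr_eq0 => /eqP dd.
have p_gt0 : 0 < m Q i by exact: m_gt0.
have yp : dot y y <= m Q i ^+ 2 by exact: dot_le_cap.
exists (dot y d / m Q i ^+ 2); apply/eqP; rewrite -subr_eq0; apply/eqP/dot_eq0.
apply/eqP; rewrite eq_le dot_ge0 andbT.
rewrite dotBl !dotBr !dotZl !dotZr (dotC d y) dd.
set c := dot y d; set p := m Q i in p_gt0 yp *.
set e := (X in X <= _).
have -> : e = c ^+ 2 / p ^+ 4 * (dot y y - p ^+ 2).
  by rewrite /e; field; rewrite gt_eqF.
by rewrite mulr_ge0_le0 ?subr_le0 // divr_ge0 ?sqr_ge0 // exprn_ge0 // ltW.
Qed.

(** Convexity of the objective with an explicit remainder: the last sum on the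
    left is what remains of the second-order term. *)
Lemma objective_bregman Q P :
  G Q + \sum_i (m Q i)^-1 * dot (Q *m x i) ((P - Q) *m x i) + \tr ((P - Q) *m A)
    + \sum_i (dot ((P - Q) *m x i) ((P - Q) *m x i)
        - dot (Q *m x i) ((P - Q) *m x i) ^+ 2 / m Q i ^+ 2) / (2 * m P i)
  <= G P.
Proof.
rewrite /G !objectiveE mulmxBl linearB /=.
set g := \sum_i (m Q i)^-1 * _; set q := \sum_i (_ / _).
suff h : \sum_i huber delta (enorm (Q *m x i)) + g + q
    <= \sum_i huber delta (enorm (P *m x i)) by lra.
rewrite /g /q -!big_split; apply: ler_sum => i _ /=.
have := @huber_bregman _ _ delta_gt0 _ (dot (Q *m x i) (P *m x i)) _ _ _
  (enorm_ge0 (Q *m x i)) (erefl (m Q i)) (erefl (m P i)).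
rewrite !enorm_sqr mulmxBl dotBl !dotBr (dotC (P *m _) (Q *m _)).
by congr (_ + _ / _ <= _); ring.
Qed.

(** The majorant with the weights of [Q] agrees with the objective at [Q] and
    dominates it at [P].  It is quadratic and stationary at [P] on matrices of
    trace one, so its values at [Q] and [P] differ by exactly the left-hand
    side. *)
Lemma objective_descent Q P : Q^T = Q -> P^T = P -> \tr (P - Q) = 0 ->
  (exists c, P *m S Q + S Q *m P + A = c%:M) ->
  \sum_i (2 * m Q i)^-1 * dot ((P - Q) *m x i) ((P - Q) *m x i) <= G Q - G P.
Proof.
move=> Qs Ps tr0 [c PE].
have Ms : (P - Q)^T = P - Q by rewrite linearB /= Qs Ps.
have : \tr ((P - Q) *m (P *m S Q + S Q *m P + A)) = 0.
  by rewrite PE mul_mx_scalar linearZ /= tr0 mulr0.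
rewrite gradient_pairing //.
rewrite mulmxBl linearB /= => st.
have : \sum_i huber delta (enorm (P *m x i))
    <= \sum_i (dot (P *m x i) (P *m x i) / (2 * m Q i) + m Q i / 2).
  apply: ler_sum => i _; rewrite -enorm_sqr huber_le ?enorm_ge0 //.
  by rewrite le_max lexx orbT.
have : \sum_i (2 * m Q i)^-1 * dot ((P - Q) *m x i) ((P - Q) *m x i) =
    \sum_i huber delta (enorm (Q *m x i))
    - \sum_i (dot (P *m x i) (P *m x i) / (2 * m Q i) + m Q i / 2)
    + \sum_i (m Q i)^-1 * dot (P *m x i) ((P - Q) *m x i).
  rewrite -sumrB -big_split; apply: eq_bigr => i _ /=.
  rewrite /huber -/(m Q i) enorm_sqr mulmxBl dotBl !dotBr (dotC (Q *m _) (P *m _)).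
  by field; rewrite gt_eqF // m_gt0.
rewrite /G !objectiveE; lra.
Qed.

End Objective.

(** * Operator norms and coercivity *)

Section OperatorNorm.
Variables (R : realType) (n : nat).
Implicit Types (u v : 'cV[R]_n) (M : 'M[R]_n).

Lemma enorm_mulmx_le M v :
  enorm (M *m v) <= Num.sqrt (\sum_i \sum_j M i j ^+ 2) * enorm v.
Proof.
have F0 : 0 <= \sum_i \sum_j M i j ^+ 2.
  by apply: sumr_ge0 => i _; apply: sumr_ge0 => j _; exact: sqr_ge0.
rewrite -(ler_pXn2r (n := 2)) ?nnegrE ?mulr_ge0 ?enorm_ge0 ?sqrtr_ge0 //.
rewrite exprMn !enorm_sqr sqr_sqrtr // mulr_suml; apply: ler_sum => i _.
have -> : (M *m v) i 0 = dot (row i M)^T v.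
  by rewrite mxE; apply: eq_bigr => j _; rewrite !mxE.
rewrite -expr2 (le_trans (dot_sqr_le _ _)) // ler_wpM2r ?dot_ge0 //.
by apply: ler_sum => j _; rewrite !mxE expr2.
Qed.

Lemma enorm_le_spectral M v : enorm v <= 1 -> enorm (M *m v) <= spectral_norm M.
Proof.
move=> v1; apply: ub_le_sup; last by exists v.
exists (Num.sqrt (\sum_i \sum_j M i j ^+ 2)) => _ [u /= u1 <-].
by rewrite (le_trans (enorm_mulmx_le _ _)) // ler_piMr ?sqrtr_ge0.
Qed.

Lemma spectral_norm_ge0 M : 0 <= spectral_norm M.
Proof.
apply: le_trans (enorm_ge0 (M *m 0)) (enorm_le_spectral _ _).
by rewrite -(scale0r 0) enormZ normr0 mul0r.
Qed.

Lemma enorm_mulmx_le_spectral M v : enorm (M *m v) <= spectral_norm M * enorm v.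
Proof.
have [->|v0] := eqVneq v 0.
  by rewrite mulmx0 -{1 2}(scale0r (0 : 'cV[R]_n)) !enormZ normr0 !mul0r mulr0.
have v_gt0 : 0 < enorm v.
  by rewrite lt0r enorm_ge0 andbT; apply: contra_neq v0 => /enorm0_eq0.
rewrite -ler_pdivrMr // mulrC -[X in X * _]ger0_norm ?invr_ge0 ?enorm_ge0 //.
rewrite -enormZ scalemxAr; apply: enorm_le_spectral.
by rewrite enormZ ger0_norm ?invr_ge0 ?enorm_ge0 // mulVf ?gt_eqF.
Qed.

Lemma dot_deltal k v : dot (delta_mx k (0 : 'I_1)) v = v k 0.
Proof.
rewrite /dot (bigD1 k) //= mxE !eqxx mul1r big1 ?addr0 // => l lk.
by rewrite mxE (negPf lk) mul0r.
Qed.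

Lemma psd_trace_ge0 M : (forall v, 0 <= dot v (M *m v)) -> 0 <= \tr M.
Proof.
move=> psd; apply: sumr_ge0 => i _.
by have := psd (delta_mx i (0 : 'I_1)); rewrite dot_deltal -colE mxE.
Qed.

(** Cauchy-Schwarz for the semidefinite form, tested on the coordinate vectors. *)
Lemma psd_entry_sqr_le M i j : M^T = M -> (forall v, 0 <= dot v (M *m v)) ->
  M i j ^+ 2 <= M i i * M j j.
Proof.
move=> Ms psd.
have form s t : 0 <= s ^+ 2 * M i i + 2 * s * t * M i j + t ^+ 2 * M j j.
  have := psd (s *: delta_mx i (0 : 'I_1) + t *: delta_mx j (0 : 'I_1)).
  rewrite mulmxDr -!scalemxAr !dotDl !dotDr !dotZl !dotZr !dot_deltal -!colE !mxE.
  have -> : M j i = M i j by rewrite -{1}Ms mxE.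
  by congr (_ <= _); ring.
have Mj := form 0 1; have {Mj} Mj : 0 <= M j j by lra.
move: Mj; rewrite le0r => /orP[/eqP Mj0|Mj_gt0]; last first.
  have := form (M j j) (- M i j); set e := (X in 0 <= X).
  have -> : e = M j j * (M i i * M j j - M i j ^+ 2) by rewrite /e; ring.
  by rewrite pmulr_rge0 // subr_ge0.
(* The form degenerates to an affine function of [t]; this [t] makes it
   [- M i j ^+ 2] at [s = M i j]. *)
have := form (M i j) (- (M i i + 1) / 2); rewrite Mj0; set e := (X in 0 <= X).
have -> : e = - M i j ^+ 2 by rewrite /e; field.
by rewrite oppr_ge0 mulr0.
Qed.

(** For a semidefinite matrix the trace bounds the Frobenius norm, hence the
    spectral norm. *)
Lemma enorm_psd_mulmx_le M v : M^T = M -> (forall v, 0 <= dot v (M *m v)) ->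
  enorm (M *m v) <= \tr M * enorm v.
Proof.
move=> Ms psd; rewrite (le_trans (enorm_mulmx_le _ _)) // ler_wpM2r ?enorm_ge0 //.
rewrite -[leRHS]ger0_norm ?psd_trace_ge0 // -sqrtr_sqr ler_sqrt ?sqr_ge0 //.
have -> : \tr M ^+ 2 = \sum_i \sum_j M i i * M j j.
  by rewrite expr2 mulr_suml; apply: eq_bigr => i _; rewrite mulr_sumr.
by apply: ler_sum => i _; apply: ler_sum => j _; exact: psd_entry_sqr_le.
Qed.

End OperatorNorm.

Section Coercivity.
Variables (R : realType) (D N : nat) (x : 'I_N -> 'cV[R]_D) (delta : R) (A : 'M[R]_D).
Hypothesis delta_gt0 : 0 < delta.
Hypothesis x_two : two_subspaces (range x).
Let S0 := weighted_scatter x delta (fun i => enorm (x i)).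
Hypothesis A_bound : spectral_norm A <= 1 / \tr (invmx S0).

Let S0_sym : S0^T = S0.
Proof. exact: scatter_sym. Qed.

Let S0_psd v : 0 <= dot v (S0 *m v).
Proof.
rewrite dot_scatter; apply: sumr_ge0 => i _.
by rewrite mulr_ge0 ?(ltW (weight_gt0 _ _)) // [dot (x i) v]dotC -expr2 sqr_ge0.
Qed.

Let S0_unit : S0 \in unitmx.
Proof.
rewrite -row_free_unit; apply: inj_row_free => v vS.
have : dot v^T (S0 *m v^T) = 0.
  by rewrite -S0_sym -trmx_mul vS trmx0 dotC dot0l.
rewrite dot_scatter => /psumr_eq0P v0.
have [//|v_neq0] := eqVneq v 0.
have vt0 : v^T != 0 by rewrite -trmx0 (inj_eq trmx_inj).
have [i [vi _]] := two_hyperplanes_do_not_cover x_two vt0 vt0.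
have /eqP : (2 * Num.max (enorm (x i)) delta)^-1 * (dot v^T (x i) * dot (x i) v^T) = 0.
  apply: v0 => // j _.
  by rewrite mulr_ge0 ?(ltW (weight_gt0 _ _)) // [dot (x j) _]dotC -expr2 sqr_ge0.
rewrite [dot (x i) _]dotC -expr2 mulf_eq0 sqrf_eq0 (negPf vi) orbF.
by rewrite gt_eqF // weight_gt0.
Qed.

(** Inserting [invmx S0 *m S0] writes the trace as a sum over the data, of
    inner products of [Q *m x i] with [A *m (invmx S0 *m x i)]; the hypothesis on
    [A] is what makes the latter vector no longer than [x i]. *)
Lemma trace_mul_le_half_sum Q : Q^T = Q ->
  `|\tr (Q *m A)| <= (\sum_i enorm (Q *m x i)) / 2.
Proof.
move=> Qs; pose T := invmx S0.
have Ts : T^T = T by rewrite /T trmx_inv S0_sym.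
have T_psd v : 0 <= dot v (T *m v).
  rewrite -[X in dot X _](mulKVmx S0_unit v) -/T dot_mull S0_sym dotC.
  by rewrite dot_mull S0_sym S0_psd.
have ATx v : enorm (A *m (T *m v)) <= enorm v.
  have sT : spectral_norm A * \tr T <= 1.
    rewrite (le_trans (ler_wpM2r (psd_trace_ge0 T_psd) A_bound)) // -/T.
    have [->|trn0] := eqVneq (\tr T) 0; first by rewrite mulr0.
    by rewrite divfK.
  rewrite (le_trans (enorm_mulmx_le_spectral _ _)) //.
  have sA := ler_wpM2l (spectral_norm_ge0 A) (enorm_psd_mulmx_le v Ts T_psd).
  rewrite (le_trans sA) // mulrA.
  by rewrite ler_piMl ?enorm_ge0.
rewrite -[A](mulmxKV S0_unit) -/T -{1}Qs trace_scatter mulr_suml.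
rewrite (le_trans (ler_norm_sum _ _ _)) //; apply: ler_sum => i _.
have w_gt0 := weight_gt0 delta_gt0 (enorm (x i)).
rewrite normrM ger0_norm ?(ltW w_gt0) // mulrC.
have := normr_dot_le (Q *m x i) (A *m T *m x i).
rewrite -mulmxA => h; rewrite (le_trans (ler_wpM2r (ltW w_gt0) h)) //.
rewrite -mulrA ler_wpM2l ?enorm_ge0 //.
rewrite (le_trans (ler_wpM2r (ltW w_gt0) (ATx _))) //.
rewrite invfM mulrA mulrAC ler_piMl // ler_pdivrMr ?cap_gt0 //.
by rewrite mul1r le_max lexx.
Qed.

Lemma half_sum_le_objective Q : Q^T = Q ->
  (\sum_i enorm (Q *m x i)) / 2 <= gms_objective x delta A Q.
Proof.
move=> Qs; rewrite (objectiveE _ _ delta_gt0).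
have := trace_mul_le_half_sum Qs; rewrite ler_norml => /andP[h _].
have : \sum_i enorm (Q *m x i) <= \sum_i huber delta (enorm (Q *m x i)).
  by apply: ler_sum => i _; exact: le_huber.
lra.
Qed.

End Coercivity.

(** * Compactness and continuity in matrix space *)

Section MatrixCompactness.
Variables (R : realType) (n : nat).
Implicit Types (M : 'M[R]_n) (B : R).

Lemma continuous_big_sum (T : topologicalType) N (f : 'I_N -> T -> R) :
  (forall i, continuous (f i)) -> continuous (fun t => \sum_i f i t).
Proof.
move=> fc t; elim: (index_enum _) => [|i s IH].
  under eq_fun do rewrite big_nil.
  exact: cvg_cst.
under eq_fun do rewrite big_cons.
by apply: cvgD; [exact: fc | exact: IH].
Qed.

Lemma continuous_add (T : topologicalType) (f g : T -> R) :
  continuous f -> continuous g -> continuous (fun t => f t + g t).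
Proof. by move=> fc gc t; apply: cvgD; [exact: fc | exact: gc]. Qed.

Lemma continuous_sub (T : topologicalType) (f g : T -> R) :
  continuous f -> continuous g -> continuous (fun t => f t - g t).
Proof. by move=> fc gc t; apply: cvgB; [exact: fc | exact: gc]. Qed.

Lemma continuous_mul (T : topologicalType) (f g : T -> R) :
  continuous f -> continuous g -> continuous (fun t => f t * g t).
Proof. by move=> fc gc t; apply: cvgM; [exact: fc | exact: gc]. Qed.

Lemma continuous_compose (T : topologicalType) (f : T -> R) (g : R -> R) :
  continuous f -> continuous g -> continuous (fun t => g (f t)).
Proof. by move=> fc gc t; apply: continuous_comp; [exact: fc | exact: gc]. Qed.

Lemma level_set_closed (T : topologicalType) (f : T -> R) a :
  continuous f -> closed [set t | f t = a].
Proof.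
move=> fc; apply: (@preimage_closed _ _ f [set y | y = a]); last exact: closed_eq.
by move=> t _; exact: fc.
Qed.

Lemma sublevel_set_closed (T : topologicalType) (f : T -> R) a :
  continuous f -> closed [set t | f t <= a].
Proof.
move=> fc; apply: (@preimage_closed _ _ f [set y | y <= a]); last exact: closed_le.
by move=> t _; exact: fc.
Qed.

Lemma vec_mx_continuous : continuous (@vec_mx R n n).
Proof.
move=> v s /nbhs_ballP[e e0 es]; apply/nbhs_ballP; exists e => // u [_ vu].
by apply: es; split=> // i j; rewrite !mxE; exact: vu.
Qed.

(** Compactness of boxes is known for row vectors and carried over by the
    continuous reshaping [vec_mx]. *)
Lemma matrix_box_compact B : compact [set M : 'M[R]_n | forall i j, `|M i j| <= B].
Proof.
have -> : [set M : 'M[R]_n | forall i j, `|M i j| <= B] =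
    vec_mx @` [set v : 'rV[R]_(n * n) | forall k, `[- B, B]%classic (v 0 k)].
  apply/seteqP; split=> M /=.
    move=> MB; exists (mxvec M); last exact: mxvecK.
    by move=> k; case/mxvec_indexP: k => i j; rewrite /= mxvecE in_itv /= -ler_norml.
  case=> v vB <- i j; rewrite mxE ler_norml.
  by have := vB (mxvec_index i j); rewrite /= in_itv.
apply: continuous_compact.
  exact: continuous_subspaceT vec_mx_continuous.
by apply: (@rV_compact _ _ (fun=> `[- B, B]%classic)) => _; exact: segment_compact.
Qed.

Lemma closed_box_minimum (K : set 'M[R]_n) B (f : 'M[R]_n -> R) :
  closed K -> (forall M, K M -> forall i j, `|M i j| <= B) -> K !=set0 ->
  continuous f -> exists2 M, K M & forall P, K P -> f M <= f P.
Proof.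
move=> Kc KB K0 fc.
have Kco : compact K by apply: (subclosed_compact Kc (@matrix_box_compact B)) => M /KB.
have [M /set_mem KM Mmin] := compact_EVT_min K0 Kco (continuous_subspaceT fc).
by exists M => // P KP; apply: Mmin; exact/mem_set.
Qed.

Lemma mx_entry_le_norm M i j : `|M i j| <= `|M|.
Proof.
by rewrite [leRHS]/Num.norm /= mx_normrE; apply/bigmax_geP; right; exists (i, j).
Qed.

(** The constant is the minimum of [f] on the unit sphere of the cone [V]; when
    this sphere is empty, [V] contains at most 0 and any constant works. *)
Lemma quadratic_lower_bound (V : set 'M[R]_n) (f : 'M[R]_n -> R) :
  closed V -> (forall a M, V M -> V (a *: M)) -> continuous f ->
  (forall a M, f (a *: M) = a ^+ 2 * f M) ->
  (forall M, V M -> M != 0 -> 0 < f M) ->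
  exists2 k, 0 < k & forall M, V M -> k * `|M| ^+ 2 <= f M.
Proof.
move=> Vc VZ fc fZ f_gt0.
pose U : set 'M[R]_n := V `&` [set M : 'M[R]_n | `|M| = 1].
have Uc : closed U.
  by apply: closedI => //; apply: level_set_closed => M; exact: norm_continuous.
have f0 : f 0 = 0 by rewrite -(scale0r (0 : 'M[R]_n)) fZ expr0n mul0r.
have normalize M : V M -> M != 0 -> U (`|M|^-1 *: M).
  move=> VM M0; split; first exact: VZ.
  by rewrite /= normrZ normfV normr_id mulVf ?normr_eq0.
have [U0|/set0P/negP/negPn/eqP U0] := pselect (U !=set0); last first.
  exists 1 => // M VM; have [->|M0] := eqVneq M 0.
    by rewrite normr0 expr0n mulr0 f0.
  by have := normalize M VM M0; rewrite U0.
have [M0 [VM0 M01] M0min] : exists2 M, U M & forall P, U P -> f M <= f P.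
  apply: (closed_box_minimum (B := 1)) => // M [_ M1] i j.
  by rewrite -M1; exact: mx_entry_le_norm.
exists (f M0).
  by apply: f_gt0 => //; rewrite -normr_eq0 M01 oner_neq0.
move=> M VM; have [->|Mn0] := eqVneq M 0.
  by rewrite normr0 expr0n mulr0 f0.
have := M0min _ (normalize M VM Mn0); rewrite fZ exprVn mulrC.
by rewrite ler_pdivlMr // exprn_gt0 // normr_gt0.
Qed.

End MatrixCompactness.

Section Continuity.
Variables (R : realType) (D N : nat) (x : 'I_N -> 'cV[R]_D) (delta : R) (A : 'M[R]_D).
Hypothesis delta_gt0 : 0 < delta.
Implicit Types (P Q M : 'M[R]_D).

Lemma mulmx_entry_continuous (v : 'cV[R]_D) i :
  continuous (fun M : 'M[R]_D => (M *m v) i 0).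
Proof.
under eq_fun do rewrite mxE.
apply: continuous_big_sum => j; apply: continuous_mul; last exact: cst_continuous.
exact: coord_continuous.
Qed.

Lemma dot_mulmx_continuous (u v : 'cV[R]_D) :
  continuous (fun M : 'M[R]_D => dot u (M *m v)).
Proof.
apply: continuous_big_sum => j; apply: continuous_mul; first exact: cst_continuous.
exact: mulmx_entry_continuous.
Qed.

Lemma dot_mulmx2_continuous (v : 'cV[R]_D) :
  continuous (fun M : 'M[R]_D => dot (M *m v) (M *m v)).
Proof.
by apply: continuous_big_sum => j; apply: continuous_mul; exact: mulmx_entry_continuous.
Qed.

Lemma trace_mul_continuous B : continuous (fun M : 'M[R]_D => \tr (M *m B)).
Proof.
apply: continuous_big_sum => i; under eq_fun do rewrite mxE.
apply: continuous_big_sum => j; apply: continuous_mul; last exact: cst_continuous.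
exact: coord_continuous.
Qed.

Lemma huber_continuous : continuous (@huber R delta).
Proof.
have mc : continuous (fun r : R => Num.max r delta).
  by move=> r; apply: continuous_max; [exact: cvg_id | exact: cvg_cst].
rewrite (_ : @huber R delta =
  fun r => r ^+ 2 / (2 * Num.max r delta) + Num.max r delta / 2) //.
apply: continuous_add; apply: continuous_mul.
- exact: exprn_continuous.
- move=> r; apply: cvgV; first by rewrite mulf_neq0 // gt_eqF // cap_gt0.
  by apply: cvgM; [exact: cvg_cst | exact: mc].
- exact: mc.
- exact: cst_continuous.
Qed.

Lemma objective_continuous : continuous (gms_objective x delta A).
Proof.
have -> : gms_objective x delta A =
    fun Q => \sum_i huber delta (Num.sqrt (dot (Q *m x i) (Q *m x i))) + \tr (Q *m A).
  by apply/funext => Q; rewrite objectiveE.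
apply: continuous_add; last exact: trace_mul_continuous.
apply: continuous_big_sum => i; apply: (continuous_compose _ huber_continuous).
apply: (continuous_compose _ (@sqrt_continuous R)).
exact: dot_mulmx2_continuous.
Qed.

Lemma transversal_energy_continuous Q : continuous (transversal_energy x delta Q).
Proof.
apply: continuous_big_sum => i; apply: continuous_sub; first exact: dot_mulmx2_continuous.
apply: continuous_mul; last exact: cst_continuous.
by apply: continuous_mul; exact: dot_mulmx_continuous.
Qed.

Lemma symmetric_trace_closed (a : R) : closed [set M : 'M[R]_D | M^T = M /\ \tr M = a].
Proof.
have -> : [set M : 'M[R]_D | M^T = M /\ \tr M = a] =
    (\bigcap_(ij : 'I_D * 'I_D) [set M : 'M[R]_D | M ij.2 ij.1 - M ij.1 ij.2 = 0])
    `&` [set M : 'M[R]_D | \tr (M *m 1%:M) = a].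
  apply/seteqP; split=> M /=.
    move=> [Ms M1]; split; last by rewrite mulmx1.
    by move=> [i j] _ /=; rewrite -{1}Ms mxE subrr.
  move=> [Ms M1]; rewrite mulmx1 in M1; split=> //; apply/matrixP => i j.
  by rewrite mxE; apply/eqP; rewrite -subr_eq0; apply/eqP/(Ms (i, j)).
apply: closedI.
  apply: closed_bigI => -[i j] _; apply: level_set_closed.
  by apply: continuous_sub; exact: coord_continuous.
by apply: level_set_closed => M; exact: trace_mul_continuous.
Qed.

End Continuity.

(** * Minimizers and linear convergence *)

Section Convergence.
Variables (R : realType) (D N : nat) (x : 'I_N -> 'cV[R]_D) (delta : R) (A : 'M[R]_D).
Hypotheses (D_gt0 : (0 < D)%N) (delta_gt0 : 0 < delta).
Hypothesis x_two : two_subspaces (range x).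
Hypothesis A_sym : A^T = A.
Hypothesis A_bound : spectral_norm A <=
  1 / \tr (invmx (weighted_scatter x delta (fun i => enorm (x i)))).
Implicit Types (P Q M : 'M[R]_D).

Let m Q i := Num.max (enorm (Q *m x i)) delta.
Let S Q := weighted_scatter x delta (fun i => enorm (Q *m x i)).
Let G := gms_objective x delta A.
Let H := @trace_one_sym R D.
Let minimizer := is_minimizer H G.

Let m_gt0 Q i : 0 < m Q i.
Proof. exact: cap_gt0. Qed.

Let mulmx_energy_le M : \sum_i dot (M *m x i) (M *m x i)
  <= (D%:R ^+ 2 * \sum_i dot (x i) (x i)) * `|M| ^+ 2.
Proof.
rewrite mulrAC mulr_sumr; apply: ler_sum => i _.
rewrite -!enorm_sqr.
have F0 : 0 <= \sum_i \sum_j M i j ^+ 2.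
  by apply: sumr_ge0 => k _; apply: sumr_ge0 => j _; exact: sqr_ge0.
have : enorm (M *m x i) ^+ 2 <= (Num.sqrt (\sum_i \sum_j M i j ^+ 2) * enorm (x i)) ^+ 2.
  by rewrite lerXn2r ?nnegrE ?mulr_ge0 ?enorm_ge0 ?sqrtr_ge0 // enorm_mulmx_le.
rewrite exprMn (sqr_sqrtr F0) => /le_trans; apply.
rewrite ler_wpM2r ?sqr_ge0 //.
have -> : D%:R ^+ 2 * `|M| ^+ 2 = \sum_(i < D) \sum_(j < D) `|M| ^+ 2.
  by rewrite !sumr_const !card_ord -mulrnA -[RHS]mulr_natl natrM -expr2.
apply: ler_sum => k _; apply: ler_sum => j _.
by rewrite -(real_normK (num_real (M k j))) lerXn2r ?nnegrE // mx_entry_le_norm.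
Qed.

Let sum_le_objective Q i : H Q -> enorm (Q *m x i) <= 2 * G Q.
Proof.
move=> [Qs _]; have := half_sum_le_objective delta_gt0 x_two A_bound Qs.
rewrite -/G (bigD1 i) //=; set s := \sum_(j < N | _) _.
have : 0 <= s by apply: sumr_ge0 => j _; exact: enorm_ge0.
lra.
Qed.

Let objective_ge0 Q : H Q -> 0 <= G Q.
Proof.
move=> [Qs _]; apply: le_trans (half_sum_le_objective delta_gt0 x_two A_bound Qs).
by rewrite divr_ge0 // sumr_ge0 // => i _; exact: enorm_ge0.
Qed.

Lemma isotropic_trace_one_sym : H (D%:R^-1)%:M.
Proof.
split; first exact: tr_scalar_mx.
by rewrite mxtrace_scalar -[LHS]mulr_natr mulVf // pnatr_eq0 -lt0n.
Qed.

(** The sublevel set of the objective through the isotropic matrix is bounded: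
    there every [|Q x_i|] is at most twice the objective, and the [x_i] span the
    space, so the sum of the [|Q x_i| ^+ 2] controls the entries of [Q]. *)
Lemma minimizer_exists : exists Q, minimizer Q.
Proof.
pose f M := \sum_i dot (M *m x i) (M *m x i).
have [||||k k_gt0 kP] := @quadratic_lower_bound R D setT f closedT.
- by [].
- by apply: continuous_big_sum => i; exact: dot_mulmx2_continuous.
- move=> a M; rewrite /f mulr_sumr; apply: eq_bigr => i _.
  by rewrite -scalemxAl dotZl dotZr mulrA expr2.
- move=> M _ M0; rewrite lt0r sumr_ge0 ?andbT => [|i _]; last exact: dot_ge0.
  apply: contra_neq M0 => /psumr_eq0P f0; apply: (mulmx_points_eq0 x_two) => i.
  by apply: dot_eq0; apply: f0 => // j _; exact: dot_ge0.
set Q0 : 'M[R]_D := (D%:R^-1)%:M; pose B := N%:R * (2 * G Q0) ^+ 2 / k + 1.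
pose K : set 'M[R]_D := H `&` [set Q | G Q <= G Q0].
have [|Q KQ i j|||Q [HQ GQ] Qmin] := @closed_box_minimum R D K B G.
- apply: closedI; first exact: symmetric_trace_closed.
  by apply: sublevel_set_closed; exact: objective_continuous.
- case: KQ => HQ GQ; have fQ : f Q <= N%:R * (2 * G Q0) ^+ 2.
    have -> : N%:R * (2 * G Q0) ^+ 2 = \sum_(i < N) (2 * G Q0) ^+ 2.
      by rewrite sumr_const card_ord mulr_natl.
    apply: ler_sum => l _; rewrite -enorm_sqr.
    have h := sum_le_objective l HQ; have h0 := enorm_ge0 (Q *m x l).
    by rewrite lerXn2r ?nnegrE //; move: GQ => /=; lra.
  have : `|Q| ^+ 2 <= N%:R * (2 * G Q0) ^+ 2 / k.
    by rewrite ler_pdivlMr // mulrC (le_trans (kP _ _)).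
  rewrite /B; move: (_ / k) (mx_entry_le_norm Q i j) => c h1 h2.
  by nra.
- by exists Q0; split; [exact: isotropic_trace_one_sym | rewrite /= lexx].
- exact: objective_continuous.
exists Q; split=> // P HP; have [PQ0|/ltW Q0P] := leP (G P) (G Q0).
  exact: Qmin.
exact: le_trans GQ Q0P.
Qed.

(** One step of the iteration from a minimizer cannot decrease the objective, so
    by [objective_descent] the step is zero. *)
Lemma minimizer_stationary Q : minimizer Q ->
  exists c, Q *m S Q + S Q *m Q + A = c%:M.
Proof.
move=> [[Qs Q1] Qmin].
have [P [PL _]] := trace_one_lyapunov_unique_existence D_gt0 delta_gt0 x_two
  (fun i => enorm (Q *m x i)) A.
have [Ps [P1 PE]] := trace_one_lyapunov_sym (scatter_sym _ _ _) A_sym PL.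
have tr0 : \tr (P - Q) = 0 by rewrite linearB /= P1 Q1 subrr.
have desc := objective_descent delta_gt0 Qs Ps tr0 PE.
have PQ : P - Q = 0.
  apply: (scatter_energy_eq0 delta_gt0 x_two (w := fun i => enorm (Q *m x i))).
  by rewrite (le_trans desc) // subr_le0; apply: Qmin.
by move/eqP: PQ; rewrite subr_eq0 => /eqP PQ; rewrite PQ in PE.
Qed.

(** At a stationary point the first-order term of [objective_bregman] vanishes.
    The weights of [P] in the remainder are bounded on sublevel sets, by
    coercivity. *)
Lemma transversal_energy_le_gap Q P g : minimizer Q -> H P -> G P <= g ->
  transversal_energy x delta Q (P - Q) <= (2 * (2 * g + delta)) * (G P - G Q).
Proof.
move=> Qmin HP Pg; have [c cE] := minimizer_stationary Qmin.
have [[Qs Q1] _] := Qmin; have [Ps P1] := HP.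
have PQs : (P - Q)^T = P - Q by rewrite linearB /= Ps Qs.
have breg := objective_bregman x A delta_gt0 Q P.
have := gradient_pairing x A delta_gt0 Q Qs PQs.
rewrite cE mul_mx_scalar linearZ /= linearB /= P1 Q1 subrr mulr0 => st.
move: breg; rewrite -addrA -addrA [X in _ + X]addrA -st add0r -/G => breg.
have mP i : m P i <= 2 * g + delta.
  have h1 := sum_le_objective i HP; have h2 := enorm_ge0 (P *m x i).
  by rewrite ge_max; apply/andP; split; move: h1 h2 Pg delta_gt0; lra.
have gd : 0 < 2 * g + delta by have := objective_ge0 HP; move: Pg delta_gt0; lra.
rewrite -ler_pdivrMl ?mulr_gt0 // lerBrDl (le_trans _ breg) // lerD2l.
rewrite mulr_sumr; apply: ler_sum => i _; rewrite mulrC ler_wpM2l //.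
  exact: transversal_energy_term_ge0.
by rewrite lef_pV2 ?posrE ?mulr_gt0 ?cap_gt0 // ler_pM2l //; exact: mP.
Qed.

Lemma minimizer_unique Q P : minimizer Q -> minimizer P -> P = Q.
Proof.
move=> Qm Pm; have [[HQ Qmin] [HP Pmin]] := (Qm, Pm).
have [[Qs Q1] [Ps P1]] := (HQ, HP).
apply/eqP; rewrite -subr_eq0; apply: contraT => PQ0.
have : 0 < transversal_energy x delta Q (P - Q).
  apply: transversal_energy_gt0 => //; first by rewrite linearB /= Ps Qs.
  by rewrite linearB /= P1 Q1 subrr.
rewrite ltNge (le_trans (transversal_energy_le_gap Qm HP (lexx _))) //.
have -> : G P = G Q by apply/eqP; rewrite eq_le Pmin // Qmin.
by rewrite subrr mulr0.
Qed.

(** By convexity the gap at [Q'] is at most the slope from [Q'] towards the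
    minimizer [Q].  The slope of the majorant at its own minimizer [P] vanishes in
    this direction, and the difference of the two slopes is the weighted inner
    product of [Q - Q'] with the step [P - Q']. *)
Lemma gap_le_pairing Q Q' P : minimizer Q -> H Q' -> H P ->
  (exists c, P *m S Q' + S Q' *m P + A = c%:M) ->
  G Q' - G Q <= \sum_i (m Q' i)^-1 * dot ((Q - Q') *m x i) ((P - Q') *m x i).
Proof.
move=> [[Qs Q1] _] [Q's Q'1] [Ps P1] [c cE].
have QQs : (Q - Q')^T = Q - Q' by rewrite linearB /= Q's Qs.
have breg := objective_bregman x A delta_gt0 Q' Q.
have := gradient_pairing x A delta_gt0 Q' Ps QQs.
rewrite cE mul_mx_scalar linearZ /= linearB /= Q'1 Q1 subrr mulr0 => st.
have -> : \sum_i (m Q' i)^-1 * dot ((Q - Q') *m x i) ((P - Q') *m x i) =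
    \sum_i (m Q' i)^-1 * dot (P *m x i) ((Q - Q') *m x i)
    - \sum_i (m Q' i)^-1 * dot (Q' *m x i) ((Q - Q') *m x i).
  rewrite -sumrB; apply: eq_bigr => i _.
  by rewrite -mulrBr -dotBl -mulmxBl dotC.
move: breg; set q := \sum_i (_ / _); rewrite -/G.
have : 0 <= q.
  apply: sumr_ge0 => i _; rewrite divr_ge0 ?transversal_energy_term_ge0 //.
  by rewrite ltW // mulr_gt0 // cap_gt0.
move: st; rewrite -/(m Q'); lra.
Qed.

(** Termwise, this is the nonnegativity of the squared length of
    [eta *: u - v], for [u = M *m x i] and [v = M' *m x i]. *)
Lemma pairing_le Q' M M' (eta : R) : 0 < eta ->
  \sum_i (m Q' i)^-1 * dot (M *m x i) (M' *m x i) <=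
  eta * \sum_i (2 * m Q' i)^-1 * dot (M *m x i) (M *m x i)
  + eta^-1 * \sum_i (2 * m Q' i)^-1 * dot (M' *m x i) (M' *m x i).
Proof.
move=> eta_gt0; rewrite !mulr_sumr -big_split; apply: ler_sum => i _ /=.
set u := M *m x i; set v := M' *m x i; have p_gt0 := m_gt0 Q' i.
have := dot_ge0 (eta *: u - v).
rewrite dotBl !dotBr !dotZl !dotZr (dotC v u) => h.
rewrite -subr_ge0; set e := (X in 0 <= X).
have -> : e = (eta * (eta * dot u u) - eta * dot u v - (eta * dot u v - dot v v))
    / (2 * m Q' i * eta).
  by rewrite /e; field; rewrite !gt_eqF.
by rewrite divr_ge0 // ltW // !mulr_gt0.
Qed.

(** Quadratic growth: [transversal_energy_le_gap] together with the definiteness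
    of the transversal energy on traceless symmetric matrices. *)
Lemma distance_le_gap Q g : minimizer Q -> exists2 c, 0 < c &
  forall P, H P -> G P <= g -> `|P - Q| ^+ 2 <= c * (G P - G Q).
Proof.
move=> Qmin; have [[Qs Q1] _] := Qmin.
pose V : set 'M[R]_D := [set M | M^T = M /\ \tr M = 0].
have [|a M [Ms M0]||a M|M [Ms M0] Mn0|k k_gt0 kP] :=
    @quadratic_lower_bound R D V (transversal_energy x delta Q).
- exact: symmetric_trace_closed.
- by split; rewrite linearZ /= ?Ms // M0 mulr0.
- exact: transversal_energy_continuous.
- exact: transversal_energyZ.
- exact: transversal_energy_gt0.
pose b := Num.max (2 * (2 * g + delta)) 1.
have b_gt0 : 0 < b by rewrite lt_max ltr01 orbT.
exists (b / k); first exact: divr_gt0.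
move=> P HP Pg; have [Ps P1] := HP.
rewrite mulrAC ler_pdivlMr // mulrC (le_trans (kP _ _)) //.
  by split; [rewrite linearB /= Ps Qs | rewrite linearB /= P1 Q1 subrr].
rewrite (le_trans (transversal_energy_le_gap Qmin HP Pg)) // ler_wpM2r //.
  by rewrite subr_ge0; case: Qmin => _; exact.
by rewrite le_max lexx.
Qed.

(** In [pairing_le], the first energy is at most [C] times the gap by quadratic
    growth, and the second at most the decrease of the gap.  The choice
    [eta = (2 * C)^-1] absorbs half of the gap, leaving
    [e / 2 <= 2 * C * (e - e')] between consecutive gaps [e] and [e']. *)
Lemma gap_contraction Q g : minimizer Q -> exists2 q : R, 0 < q < 1 &
  forall Q' P, H Q' -> H P -> G Q' <= g ->
    (exists c, P *m S Q' + S Q' *m P + A = c%:M) ->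
    G P - G Q <= q * (G Q' - G Q).
Proof.
move=> Qmin; have [[Qs Q1] Qle] := Qmin.
have [c c_gt0 cP] := distance_le_gap g Qmin.
have [a a_ge0 aP] : exists2 a, 0 <= a &
    forall M, \sum_i dot (M *m x i) (M *m x i) <= a * `|M| ^+ 2.
  exists (D%:R ^+ 2 * \sum_i dot (x i) (x i)); last exact: mulmx_energy_le.
  by rewrite mulr_ge0 ?sqr_ge0 // sumr_ge0 // => i _; exact: dot_ge0.
(* The summand 1 keeps the contraction factor positive. *)
pose C := (2 * delta)^-1 * (a * c) + 1.
have C_ge1 : 1 <= C.
  have d0 : 0 <= (2 * delta)^-1 by rewrite invr_ge0 mulr_ge0 // ltW.
  by rewrite lerDr mulr_ge0 // mulr_ge0 // ltW.
have C_gt0 : 0 < C := lt_le_trans ltr01 C_ge1.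
exists (1 - (4 * C)^-1).
  rewrite subr_gt0 invf_lt1 ?mulr_gt0 // gtrBl invr_gt0 mulr_gt0 // andbT.
  by move: C_ge1; lra.
move=> Q' P HQ' HP Q'g PE; have [[Q's Q'1] [Ps P1]] := (HQ', HP).
have gap_ge0 : 0 <= G Q' - G Q by rewrite subr_ge0 Qle.
have energy_le : \sum_i (2 * m Q' i)^-1 * dot ((Q - Q') *m x i) ((Q - Q') *m x i)
    <= C * (G Q' - G Q).
  apply: (@le_trans _ _ ((2 * delta)^-1 * (a * `|Q - Q'| ^+ 2))).
    apply: le_trans (ler_wpM2l _ (aP _)); last first.
      by rewrite invr_ge0 mulr_ge0 // ltW.
    rewrite mulr_sumr; apply: ler_sum => i _; rewrite ler_wpM2r ?dot_ge0 //.
    by rewrite lef_pV2 ?posrE ?mulr_gt0 // ler_pM2l // /m le_max lexx orbT.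
  rewrite /C [leRHS]mulrDl mul1r; apply: ler_wpDr => //; rewrite -!mulrA ler_wpM2l //.
    by rewrite invr_ge0 mulr_ge0 // ltW.
  by rewrite ler_wpM2l // distrC cP.
have tr0 : \tr (P - Q') = 0 by rewrite linearB /= P1 Q'1 subrr.
have desc := objective_descent delta_gt0 Q's Ps tr0 PE; rewrite -/G in desc.
have eta_gt0 : 0 < (2 * C)^-1 by rewrite invr_gt0 mulr_gt0.
have pair := le_trans (gap_le_pairing Qmin HQ' HP PE) (pairing_le Q' _ _ eta_gt0).
have h1 := ler_wpM2l (ltW eta_gt0) energy_le.
have h2 : (2 * C)^-1^-1 * \sum_i (2 * m Q' i)^-1 * dot ((P - Q') *m x i) ((P - Q') *m x i)
    <= (2 * C)^-1^-1 * (G Q' - G P) by rewrite ler_wpM2l // invr_ge0 ltW.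
have h3 := le_trans pair (lerD h1 h2).
have e1 : (2 * C)^-1 * (C * (G Q' - G Q)) = (G Q' - G Q) / 2.
  by field; rewrite gt_eqF.
rewrite e1 invrK in h3.
rewrite mulrBl mul1r lerBrDl -lerBrDr ler_pdivrMl ?mulr_gt0 //.
by move: h3; lra.
Qed.

End Convergence.

(** * The iteration *)

Section Iteration.
Variables (R : realType) (D N : nat) (x : 'I_N -> 'cV[R]_D) (delta : R) (A : 'M[R]_D).
Hypotheses (D_gt0 : (0 < D)%N) (delta_gt0 : 0 < delta).
Hypothesis x_two : two_subspaces (range x).
Let S (Q : 'M[R]_D) := weighted_scatter x delta (fun i => enorm (Q *m x i)).

Lemma gms_iteration_unique_existence : exists! Q, gms_iteration x delta A Q.
Proof.
have next_ex (Q : 'M[R]_D) := trace_one_lyapunov_unique_existence D_gt0 delta_gt0 x_two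
  (fun i => enorm (Q *m x i)) A.
pose next Q := projT1 (cid (next_ex Q)).
have nextP Q : unique (trace_one_lyapunov_solution (S Q) A) (next Q).
  exact: projT2 (cid (next_ex Q)).
exists (fun t => iter t next (D%:R^-1)%:M); split.
  by split=> // t; exact: (nextP _).1.
move=> Q [Q0 QS]; apply/funext; elim=> [|t IH] /=; first by rewrite Q0.
by rewrite IH; apply: (nextP _).2; exact: QS.
Qed.

Lemma gms_iteration_step Q t : A^T = A -> gms_iteration x delta A Q ->
  trace_one_sym (Q t) /\ exists c, Q t.+1 *m S (Q t) + S (Q t) *m Q t.+1 + A = c%:M.
Proof.
move=> As [Q0 QS].
have step s := trace_one_lyapunov_sym (scatter_sym _ _ _) As (QS s).
split; last by have [_ [_]] := step t.
case: t => [|t]; first by rewrite Q0; exact: isotropic_trace_one_sym.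
by have [? [? _]] := step t.
Qed.

End Iteration.

Lemma matrix_norm_le_sup_norm (R : realType) (n : nat) (nrm : 'M[R]_n -> R) :
  matrix_norm nrm -> exists2 c, 0 <= c & forall M, nrm M <= c * `|M|.
Proof.
move=> [nrm_ge0 _ nrmZ nrmD].
have nrm0 : nrm 0 = 0 by rewrite -(scale0r 0) nrmZ normr0 mul0r.
have nrm_sum m (F : 'I_m -> 'M[R]_n) : nrm (\sum_i F i) <= \sum_i nrm (F i).
  elim/big_ind2: _ => [|y M z P yM zP|//]; first by rewrite nrm0.
  exact: le_trans (nrmD _ _) (lerD yM zP).
exists (\sum_i \sum_j nrm (delta_mx i j)).
  by apply: sumr_ge0 => i _; apply: sumr_ge0 => j _; exact: nrm_ge0.
move=> M; rewrite [M in leLHS]matrix_sum_delta (le_trans (nrm_sum _ _)) // mulr_suml.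
apply: ler_sum => i _; rewrite (le_trans (nrm_sum _ _)) // mulr_suml.
apply: ler_sum => j _; rewrite nrmZ mulrC ler_wpM2l //.
exact: mx_entry_le_norm.
Qed.

(** The squared distances are dominated by the gaps, so the distances decay at
    rate [s = Num.sqrt q]. *)
Lemma rlinear_cvg_of_gap (R : realType) (n : nat) (nrm : 'M[R]_n -> R)
    (y : nat -> 'M[R]_n) (l : 'M[R]_n) (gap : nat -> R) (c q : R) :
  matrix_norm nrm -> 0 <= c -> 0 < q < 1 ->
  (forall t, `|y t - l| ^+ 2 <= c * gap t) ->
  (forall t, 0 <= gap t) -> (forall t, gap t.+1 <= q * gap t) ->
  rlinear_cvg nrm y l.
Proof.
move=> /matrix_norm_le_sup_norm[b b_ge0 bP] c_ge0 /andP[q_gt0 q_lt1] dist gap_ge0 gapS.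
have gapt t : gap t <= q ^+ t * gap 0%N.
  elim: t => [|t IH]; first by rewrite expr0 mul1r.
  by rewrite (le_trans (gapS t)) // exprS -mulrA ler_wpM2l // ltW.
pose s := Num.sqrt q; have s_gt0 : 0 < s by rewrite sqrtr_gt0.
have sq : s ^+ 2 = q by rewrite sqr_sqrtr // ltW.
have s_lt1 : s < 1 by rewrite -sqrtr1 ltr_sqrt.
pose k := Num.sqrt (c * gap 0%N).
have distt t : `|y t - l| <= k * s ^+ t.
  rewrite -(ler_pXn2r (n := 2)) ?nnegrE ?mulr_ge0 ?sqrtr_ge0 ?exprn_ge0 ?(ltW s_gt0) //.
  rewrite exprMn sqr_sqrtr ?mulr_ge0 // exprAC sq (le_trans (dist t)) //.
  by rewrite -mulrA ler_wpM2l // mulrC.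
(* The summand 1 makes the bound strict even when the initial gap is 0. *)
exists (fun t => (b * k + 1) * s ^+ t); split.
  move=> t; rewrite (le_lt_trans (bP _)) // (le_lt_trans (ler_wpM2l b_ge0 (distt t))) //.
  by rewrite mulrA ltr_pM2r ?exprn_gt0 // ltrDl.
exists s; first by rewrite s_gt0.
by apply: nearW => t; rewrite exprS mulrCA.
Qed.

Theorem theorem1 (R : realType) (D N : nat) (x : 'I_N -> 'cV[R]_D)
    (delta : R) (A : 'M[R]_D) (D_gt0 : (0 < D)%N) (delta_gt0 : 0 < delta)
    (x_two_subspaces : two_subspaces (range x))
    (A_sym : A^T = A) (A_tr0 : \tr A = 0)
    (A_bound : spectral_norm A <=
       1 / \tr (invmx (weighted_scatter x delta (fun i => enorm (x i))))) :
  [/\ exists! Q : nat -> 'M[R]_D, gms_iteration x delta A Q,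
      exists! Qmin : 'M[R]_D,
        is_minimizer (@trace_one_sym R D) (gms_objective x delta A) Qmin
    & forall (nrm : 'M[R]_D -> R) (Q : nat -> 'M[R]_D) (Qmin : 'M[R]_D),
        matrix_norm nrm ->
        gms_iteration x delta A Q ->
        is_minimizer (@trace_one_sym R D) (gms_objective x delta A) Qmin ->
        rlinear_cvg nrm Q Qmin].
Proof.
split; first exact: gms_iteration_unique_existence.
  have [Qmin QminP] := minimizer_exists D_gt0 delta_gt0 x_two_subspaces A_bound.
  exists Qmin; split=> // P PP; apply: esym.
  exact: (minimizer_unique D_gt0 delta_gt0 x_two_subspaces A_sym A_bound QminP PP).
move=> nrm Q Qmin nrmP QP QminP; pose G := gms_objective x delta A.
have step t := gms_iteration_step D_gt0 t A_sym QP.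
have G_le0 t : G (Q t) <= G (Q 0%N).
  elim: t => [//|t]; apply: le_trans.
  have [[[Qs Q1] QE] [[Qs' Q1'] _]] := (step t, step t.+1).
  have tr0 : \tr (Q t.+1 - Q t) = 0 by rewrite linearB /= Q1 Q1' subrr.
  rewrite -subr_ge0; apply: le_trans (objective_descent delta_gt0 Qs Qs' tr0 QE).
  apply: sumr_ge0 => i _; rewrite mulr_ge0 ?dot_ge0 // ltW //.
  exact: weight_gt0.
have [c c_gt0 cP] :=
  distance_le_gap D_gt0 delta_gt0 x_two_subspaces A_sym A_bound (G (Q 0%N)) QminP.
have [q q01 qP] :=
  gap_contraction D_gt0 delta_gt0 x_two_subspaces A_sym A_bound (G (Q 0%N)) QminP.
apply: (rlinear_cvg_of_gap (gap := fun t => G (Q t) - G Qmin) nrmP (ltW c_gt0) q01) => t.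
- by apply: cP => //; exact: (step t).1.
- by rewrite subr_ge0; apply: QminP.2; exact: (step t).1.
- by apply: qP; [exact: (step t).1 | exact: (step t.+1).1 | | exact: (step t).2].
Qed.
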